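(* Let $F$ be an infinite field and let $A$ be an associative $F$-algebra (not assumed commutative, and not assumed to have an identity element) with $\dim_F(A)=3$. Then $A$ is right tame; that is, the set of right zero divisors of $A$ is the union of at most finitely many linear subspaces of $A$.
   Context: An $F$-algebra $A$ is an $F$-vector space with a bilinear multiplication $A\times A\to A$; it is associative if $(xy)z=x(yz)$ for all $x,y,z\in A$. An element $z\in A$ is a right zero divisor if there exists a nonzero $w\in A$ with $wz=0$ (so $z=0$ is allowed). $Z$ denotes the set of all right zero divisors. $A$ is right tame if $Z$ is the union of at most finitely many linear subspaces ($F$-subspaces) of $A$. *)

(* Defs.v *)
From mathcomp Require Import all_boot all_order all_algebra.
From mathcomp Require Import boolp classical_sets cardinality.

Set Implicit Arguments.
Unset Strict Implicit.
Unset Printing Implicit Defensive.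

Import GRing.Theory.
Local Open Scope ring_scope.
Local Open Scope classical_set_scope.

(* An F-algebra is a vector space A with a bilinear mul : A -> A -> A.
   MathComp's algebra structures all carry a unit, so the multiplication is
   kept as an explicit bilinear map. *)

Definition right_zero_divisors (F : fieldType) (A : vectType F)
    (mul : {bilinear A -> A -> A}) : set A :=
  [set z | exists2 w : A, w != 0 & mul w z = 0].

Definition right_tame (F : fieldType) (A : vectType F)
    (mul : {bilinear A -> A -> A}) : Prop :=
  exists2 S : set {vspace A}, finite_set S &
    right_zero_divisors mul = \bigcup_(U in S) [set` U].

(* Main.v *)
Require Import Defs.
From mathcomp Require Import all_boot all_order all_algebra.
From mathcomp Require Import boolp classical_sets cardinality.
From mathcomp Require Import zify.

Import GRing.Theory.
Local Open Scope ring_scope.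
Local Open Scope classical_set_scope.

(** If every element is a right zero divisor, the single subspace [A] will do.
    Otherwise some right multiplication is bijective, and this forces a right
    identity (lemma [right_identity_exists]).

    In the presence of a right identity [z] is a right zero divisor iff [A z]
    is not all of [A], iff [z] lies in a proper left ideal; so the right zero
    divisors form the union of the maximal left ideals
    (lemma [right_zero_divisors_maximal]), and it remains to see that an
    algebra of dimension 3 has finitely many of these.

    Maximal left ideals behave like primes: if [I J] is contained in the
    maximal left ideal [M] and [J] is a left ideal, then [I] or [J] is
    contained in [M] (lemma [maximal_left_ideal_prime]).  Hence a maximal left
    ideal containing a product of maximal left ideals is one of the factors.
    In dimension 3 there are few factors to consider: two
    distinct ones [M1], [M2] span [A], so one of them, say [M1], is a plane and
    therefore two-sided (lemma [hyperplane_right_ideal]).  Then [M1 M2] lies in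
    [P], the intersection of [M1] and [M2].  If every maximal left ideal
    contains [P], only [M1] and [M2] occur.  If some [M3] does not, then [P] is
    a line meeting [M3] trivially, [M2] is a plane too, so [P] is two-sided and
    [P M3 = 0]; only [M1], [M2] and [M3] occur. *)

Section LeftIdeals.

Set Implicit Arguments.
Unset Strict Implicit.

Variables (F : fieldType) (A : vectType F) (mul : {bilinear A -> A -> A}).
Hypothesis mulA : forall x y z : A, mul (mul x y) z = mul x (mul y z).

Implicit Types (U V M : {vspace A}) (x y z w : A).

Definition rmul z : 'End(A) := linfun (applyr mul z).

Definition left_ideal U := forall x y, y \in U -> mul x y \in U.

Definition right_ideal U := forall x y, x \in U -> mul x y \in U.

Definition maximal_left_ideal M :=
  [/\ left_ideal M, M != fullv &
      forall U, left_ideal U -> (M <= U)%VS -> U != fullv -> U = M].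

Lemma rmulE z w : rmul z w = mul w z.
Proof. by rewrite lfunE. Qed.

Lemma rmul_injective z :
  ~ right_zero_divisors mul z -> lker (rmul z) == 0%VS.
Proof.
move=> Zz; rewrite -subv0; apply/subvP => w.
rewrite memv_ker rmulE memv0 => /eqP wz0.
by apply/negP => /negP w0; apply: Zz; exists w.
Qed.

Lemma left_idealD U V : left_ideal U -> left_ideal V -> left_ideal (U + V)%VS.
Proof.
move=> lU lV x _ /memv_addP[u Uu [v Vv ->]].
by rewrite linearDr memv_add ?lU ?lV.
Qed.

Lemma left_idealI U V :
  left_ideal U -> left_ideal V -> left_ideal (U :&: V)%VS.
Proof. by move=> lU lV x y /memv_capP[/lU Uy /lV Vy]; apply/memv_capP. Qed.

(** Right multiplication by an element that is not a right zero divisor is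
    injective, hence onto, while it maps [A] into any left ideal containing
    that element. *)
Lemma proper_left_ideal_zero_divisor U z : left_ideal U -> U != fullv ->
  z \in U -> right_zero_divisors mul z.
Proof.
move=> lU /negP Uproper Uz; apply: contrapT => /rmul_injective /lker0_limgf Rz.
apply: Uproper; rewrite eqEsubv subvf /= -Rz.
by apply/subvP => _ /memv_imgP[w _ ->]; rewrite rmulE lU.
Qed.

Lemma proper_left_ideal_maximal U : left_ideal U -> U != fullv ->
  exists2 M, maximal_left_ideal M & (U <= M)%VS.
Proof.
have [n] := ubnP (\dim {:A} - \dim U)%N.
elim: n U => // n IHn U leUn lU Uproper.
have [Umax|/existsNP[V]] :=
  pselect (forall V, left_ideal V -> (U <= V)%VS -> V != fullv -> V = U).
  by exists U.
move=> /not_implyP[lV] /not_implyP[UV] /not_implyP[Vproper /eqP VneqU].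
have ltUV : (\dim U < \dim V)%N.
  by rewrite ltnNge; apply: contra VneqU => leVU; rewrite eq_sym eqEdim UV.
have leV := dimvS (subvf V).
have [|M Mmax VM] := IHn V _ lV Vproper; first by lia.
by exists M => //; apply: subv_trans VM.
Qed.

Lemma maximal_left_ideal_add M U : maximal_left_ideal M -> left_ideal U ->
  ~~ (U <= M)%VS -> (M + U)%VS = fullv.
Proof.
move=> [lM Mproper Mmax] lU UM; apply/eqP/negP => /negP MUproper; case/negP: UM.
rewrite -(Mmax _ (left_idealD lM lU) _ MUproper) ?addvSl//.
exact: addvSr.
Qed.

Lemma maximal_left_ideal_sub M M' : maximal_left_ideal M ->
  maximal_left_ideal M' -> (M <= M')%VS -> M' = M.
Proof. by move=> [_ _ Mmax] [lM' M'proper _] MM'; apply: Mmax. Qed.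

(** If [a] is not a right zero divisor then [a = f a] for some [f], and
    cancelling [a] on the right of [(w f) a = w a] shows that [f] is a right
    identity. *)
Lemma right_identity_exists a :
  ~ right_zero_divisors mul a -> exists f, forall w, mul w f = w.
Proof.
move=> /rmul_injective Ra; exists ((rmul a)^-1%VF a) => w.
apply: (lker0P Ra); rewrite !rmulE mulA; congr (mul w _).
by rewrite -rmulE lker0_lfunVK.
Qed.

Section RightIdentity.

Variable f : A.
Hypothesis mulf : forall w, mul w f = w.

(** A right zero divisor [z] lies in the left ideal [A z + F z].  If this were
    all of [A], it would contain the right identity, [f = a z + c z], and
    [x = x f] would then lie in [A z] for all [x]; but [A z] is not all of [A]
    because right multiplication by [z] has a kernel. *)
Lemma zero_divisor_proper_left_ideal z : right_zero_divisors mul z ->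
  exists U, [/\ left_ideal U, U != fullv & z \in U].
Proof.
move=> [w w0 wz0]; exists (limg (rmul z) + <[z]>)%VS; split; last first.
- by rewrite (subvP (addvSr _ _)) ?memv_line.
- apply/negP => /eqP Ufull.
  have: f \in (limg (rmul z) + <[z]>)%VS by rewrite Ufull memvf.
  move=> /memv_addP[_ /memv_imgP[a _ ->] [_ /vlineP[c ->] fE]].
  have Rfull : limg (rmul z) = fullv.
    apply/eqP; rewrite eqEsubv subvf /=; apply/subvP => x _.
    rewrite -[x]mulf fE rmulE linearDr linearZr_LR -mulA -!rmulE.
    by rewrite memvD ?memvZ ?memv_img ?memvf.
  have := limg_ker_dim (rmul z) fullv; rewrite Rfull capfv.
  move=> /(canRL (addnK _)); rewrite subnn => /eqP; rewrite dimv_eq0 => kz.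
  by case/negP: w0; apply/eqP/(lker0P kz); rewrite linear0 rmulE.
move=> x _ /memv_addP[_ /memv_imgP[a _ ->] [_ /vlineP[c ->] ->]].
rewrite rmulE linearDr linearZr_LR -mulA -!rmulE.
by rewrite (subvP (addvSl _ _)) // memvD ?memvZ ?memv_img ?memvf.
Qed.

Lemma right_zero_divisors_maximal :
  right_zero_divisors mul = \bigcup_(M in maximal_left_ideal) [set` M].
Proof.
apply/seteqP; split=> [z|z [M [lM Mproper _] Mz]]; last first.
  exact: proper_left_ideal_zero_divisor Mz.
move=> /zero_divisor_proper_left_ideal[U [lU Uproper Uz]].
have [M Mmax UM] := proper_left_ideal_maximal lU Uproper.
by exists M; rewrite /= ?(subvP UM).
Qed.

(** If [V] is not contained in [M] then [M + V = A] contains [f], so that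
    [U = U f] is contained in [U M + U V], hence in [M]. *)
Lemma maximal_left_ideal_prime M U V : maximal_left_ideal M -> left_ideal V ->
  (forall x y, x \in U -> y \in V -> mul x y \in M) ->
  (U <= M)%VS \/ (V <= M)%VS.
Proof.
move=> Mmax lV UVM; have [|VM] := boolP (V <= M)%VS; first by right.
left; apply/subvP => u Uu; have [lM _ _] := Mmax.
have: f \in (M + V)%VS by rewrite (maximal_left_ideal_add Mmax) ?memvf.
move=> /memv_addP[m Mm [v Vv fE]].
by rewrite -[u]mulf fE linearDr; apply: memvD; [exact: lM | exact: UVM].
Qed.

(** The right identity lies outside the proper left ideal [U], so
    [A = U + F f] when [U] is a hyperplane; and right multiplication by
    [u + c f] maps [U] into [U]. *)
Lemma hyperplane_right_ideal U : left_ideal U ->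
  (\dim U).+1 = \dim {:A} -> right_ideal U.
Proof.
move=> lU dimU u x Uu.
have fU : f \notin U.
  apply/negP => Uf; suff: (\dim {:A} <= \dim U)%N by rewrite -dimU ltnn.
  by apply/dimvS/subvP => y _; rewrite -[y]mulf lU.
have: x \in (U + <[f]>)%VS.
  suff ->: (U + <[f]>)%VS = fullv by rewrite memvf.
  apply/eqP; rewrite eqEdim subvf -dimU ltnNge; apply/negP => leU.
  case/negP: fU; have /eqP ->: U == (U + <[f]>)%VS.
    by rewrite eqEdim addvSl.
  by rewrite (subvP (addvSr _ _)) ?memv_line.
move=> /memv_addP[v Uv [_ /vlineP[c ->] ->]].
by rewrite linearDr linearZr_LR mulf memvD ?memvZ ?lU.
Qed.

Lemma finite_maximal_left_ideals :
  \dim {:A} = 3%N -> finite_set maximal_left_ideal.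
Proof.
move=> dimA.
have dimM M : maximal_left_ideal M -> (\dim M <= 2)%N.
  move=> [_ Mproper _]; rewrite -ltnS -dimA ltnNge.
  by apply: contra Mproper => leM; rewrite eqEdim subvf.
have neq_add M M' : maximal_left_ideal M -> maximal_left_ideal M' ->
    M' <> M -> (M + M')%VS = fullv.
  move=> Mmax M'max neq; have [lM' _ _] := M'max.
  apply: maximal_left_ideal_add => //; apply/negP => M'M.
  by apply: neq; rewrite (maximal_left_ideal_sub M'max Mmax M'M).
have [[M1 [M2 [M1max M2max neq21 dimM1]]]|no_pair] := pselect (exists M1 M2,
    [/\ maximal_left_ideal M1, maximal_left_ideal M2, M2 <> M1
      & \dim M1 = 2%N]); last first.
  (* Two distinct maximal left ideals span [A], so one of them is a plane. *)
  have [[M1 M1max]|no_max] := pselect (exists M, maximal_left_ideal M).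
    apply: (@sub_finite_set _ _ [set M1]); last exact: finite_set1.
    move=> M Mmax /=; apply: contrapT => neq; apply: no_pair.
    have := dimv_sum_cap M1 M; rewrite neq_add // dimA => dims.
    have [dM1 dM] := (dimM _ M1max, dimM _ Mmax).
    have [dimM1|dimM1] := eqVneq (\dim M1) 2%N; first by exists M1, M.
    by exists M, M1; split=> //; [exact: nesym | lia].
  apply: (@sub_finite_set _ _ set0) => // M Mmax.
  by apply: no_max; exists M.
have [[lM1 _ _] [lM2 _ _]] := (M1max, M2max).
have rM1 : right_ideal M1 by apply: hyperplane_right_ideal; rewrite ?dimM1.
pose P := (M1 :&: M2)%VS; have lP : left_ideal P by exact: left_idealI.
have dimP : (3 + \dim P = 2 + \dim M2)%N.
  by have := dimv_sum_cap M1 M2; rewrite neq_add // dimA dimM1.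
have above_P M : maximal_left_ideal M -> (P <= M)%VS -> M = M1 \/ M = M2.
  move=> Mmax PM; have [] := @maximal_left_ideal_prime M M1 M2 Mmax lM2.
  - move=> x y M1x M2y; apply: (subvP PM).
    by apply/memv_capP; split; [exact: rM1 | exact: lM2].
  - by move=> /(maximal_left_ideal_sub M1max Mmax); left.
  - by move=> /(maximal_left_ideal_sub M2max Mmax); right.
have [[M3 M3max PM3]|all_above] :=
  pselect (exists2 M, maximal_left_ideal M & ~~ (P <= M)%VS); last first.
  apply: (@sub_finite_set _ _ [set M1; M2]); last exact: finite_set2.
  move=> M Mmax /=; apply: above_P => //; apply: contrapT => /negP PM.
  by apply: all_above; exists M.
have := dimv_sum_cap M3 P; rewrite (maximal_left_ideal_add M3max) // dimA => dims.
have [dM2 dM3] := (dimM _ M2max, dimM _ M3max).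
have rM2 : right_ideal M2 by apply: hyperplane_right_ideal => //; lia.
have M3P0 : (M3 :&: P)%VS = 0%VS by apply/eqP; rewrite -dimv_eq0; lia.
have [lM3 _ _] := M3max.
apply: (@sub_finite_set _ _ [set M1; M2; M3]); last exact: finite_set3.
move=> M Mmax /=; have [] := @maximal_left_ideal_prime M P M3 Mmax lM3.
- move=> x y /memv_capP[M1x M2x] M3y.
  suff: mul x y \in (M3 :&: P)%VS by rewrite M3P0 memv0 => /eqP ->; apply: mem0v.
  apply/memv_capP; split; first exact: lM3.
  by apply/memv_capP; split; [exact: rM1 | exact: rM2].
- by move=> /(above_P M Mmax)[]; [left; left | left; right].
- by move=> /(maximal_left_ideal_sub M3max Mmax); right.
Qed.

End RightIdentity.

End LeftIdeals.

Theorem mainTheorem2 (F : fieldType) (hF : infinite_set [set: F])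
    (A : vectType F) (dimA : \dim {:A} = 3%N)
    (mul : {bilinear A -> A -> A})
    (mulA : forall x y z : A, mul (mul x y) z = mul x (mul y z)) :
  right_tame mul.
Proof.
have [[a /(right_identity_exists mulA)[f mulf]]|all_zero_divisors] :=
  pselect (exists a, ~ right_zero_divisors mul a).
  exists (maximal_left_ideal mul).
    exact: finite_maximal_left_ideals mulf dimA.
  exact: right_zero_divisors_maximal mulf.
exists [set fullv]; first exact: finite_set1.
rewrite bigcup_set1; apply/seteqP; split=> z _ /=; first exact: memvf.
by apply: contrapT => Zz; apply: all_zero_divisors; exists z.
Qed.
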